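(* Let $n,d\ge 2$ and let $\mathcal{I}$ be a partial $3$-$(n^d+1,n+1,1)$-design. Suppose that for every point $P$ of $\mathcal{I}$, the derived structure $\mathcal{I}_P$ can be uniquely extended to a full $2$-$(n^d,n,1)$-design $\mathcal{I}'_P$, and that in $\mathcal{I}'_P$ one of the following holds: (i) every added line in $\mathcal{I}'_P$ contains at least $\sqrt n$ simple points, and through every point of $\mathcal{I}'_P$ there are at most $\sqrt n$ added lines of $\mathcal{I}'_P$; or (ii) there is at most one point in $\mathcal{I}'_P$ with more than one added line of $\mathcal{I}'_P$ through it. Then $\mathcal{I}$ can be uniquely completed to a full $3$-$(n^d+1,n+1,1)$-design.
   Context: A $t$-$(v,k,\lambda)$-design (respectively partial $t$-$(v,k,\lambda)$-design) is an incidence structure consisting of a set of $v$ points and a set of $k$-element subsets of points (blocks) such that every set of $t$ points lies in exactly (respectively at most) $\lambda$ blocks. For $t=2$ blocks are called lines; for $t=3$ blocks are called circles. A partial design can be completed (extended) to a full design if there is a full design with the same parameters on the same point set whose block set contains the given block set; uniquely, if there is exactly one such full design. For a partial $3$-$(n^d+1,n+1,1)$-design $\mathcal{I}$ and a point $P$, the derived structure $\mathcal{I}_P$ has as points the points of $\mathcal{I}$ different from $P$, and as lines the sets $C\setminus\{P\}$ for circles $C$ of $\mathcal{I}$ containing $P$; it is a partial $2$-$(n^d,n,1)$-design. If $\mathcal{I}_P$ is extended to a full $2$-$(n^d,n,1)$-design $\mathcal{I}'_P$, an added line is a line of $\mathcal{I}'_P$ that is not a line of $\mathcal{I}_P$.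 A point of $\mathcal{I}'_P$ is simple if exactly one added line of $\mathcal{I}'_P$ passes through it, i.e. if it lies on exactly $\frac{n^d-1}{n-1}-1$ lines of $\mathcal{I}_P$. *)

(* Defs.v *)
From mathcomp Require Import all_boot all_order all_algebra all_field.

Set Implicit Arguments.
Unset Strict Implicit.
Unset Printing Implicit Defensive.

Import Order.TTheory GRing.Theory Num.Theory.

(* The points form a subset of an ambient finite type, so that a structure, its
   derived structures and their extensions live over the same type. *)
Record incidence (T : finType) := Incidence {
  points : {set T};
  blocks : {set {set T}}
}.

Section Designs.

Variable T : finType.
Implicit Types (D E : incidence T) (B L S : {set T}) (P Q : T).

Definition block_degree D S : nat := #|[set B in blocks D | S \subset B]|.

Definition uniform_on (v k : nat) D : Prop :=
  #|points D| = v /\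
  forall B, B \in blocks D -> B \subset points D /\ #|B| = k.

Definition partial_design (t v k lam : nat) D : Prop :=
  uniform_on v k D /\
  forall S, S \subset points D -> #|S| = t -> block_degree D S <= lam.

Definition design (t v k lam : nat) D : Prop :=
  uniform_on v k D /\
  forall S, S \subset points D -> #|S| = t -> block_degree D S = lam.

Definition completes (t v k lam : nat) D E : Prop :=
  [/\ design t v k lam E, points E = points D & blocks D \subset blocks E].

Definition derived D P : incidence T :=
  Incidence (points D :\ P) [set C :\ P | C : {set T} in blocks D & P \in C].

(* In what follows, E is a full design extending D. *)
Definition added_lines D E : {set {set T}} := blocks E :\: blocks D.

Definition added_through D E Q : {set {set T}} :=
  [set L in added_lines D E | Q \in L].

Definition simple_points D E : {set T} :=
  [set Q in points E | #|added_through D E Q| == 1].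

(* Square roots are taken in the real closed field of real algebraic numbers. *)
Definition many_simple_points (n : nat) D E : Prop :=
  (forall L, L \in added_lines D E ->
     (Num.sqrt (n%:R : algR) <= #|L :&: simple_points D E|%:R)%R) /\
  (forall Q, Q \in points E ->
     (#|added_through D E Q|%:R <= Num.sqrt (n%:R : algR))%R).

Definition at_most_one_multiple_point D E : Prop :=
  #|[set Q in points E | 1 < #|added_through D E Q|]| <= 1.

End Designs.

(* Main.v *)
Require Import Defs.
From mathcomp Require Import all_boot all_order all_algebra all_field.

Set Implicit Arguments.
Unset Strict Implicit.
Unset Printing Implicit Defensive.

Import Order.TTheory GRing.Theory Num.Theory.

(* Call a triple of points uncovered if no circle of [I] contains it. For an
   added line [L] of [E P], the set [C = P |: L] is the only candidate for a
   circle through its uncovered triples containing [P], and everything reduces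
   to showing that [C :\ R] is a line of [E R] for each [R] in [L]. A point [Q]
   is simple in [E P] iff [n - 1] points complete [P], [Q] to an uncovered
   triple; this is symmetric, so the claim holds for simple [R]. For general
   [R], take [Q] simple in [E P] on [L]. If [P] or [Q] is simple in [E R], the
   line through it is forced to be [C :\ R]; this settles case (ii) at [R].
   In case (i) at [R], the line [M] of [E R] through [P] and [Q] has a simple
   point [Y]; as [P], [Q], [Y] is uncovered, [Y] lies on [L]. Simplicity of [Y]
   puts [P] and all simple points of [L] on [M], and a point of [C :\ R] off
   [M] would then lie on more than [sqrt n] added lines of [E R]. *)

(** * Comparison of naturals with real square roots *)

Lemma sqrt_nat_le (m n : nat) :
  (Num.sqrt (n%:R : algR) <= m%:R)%R = (n <= m ^ 2).
Proof.
rewrite -[X in (_ <= X)%R](@ger0_norm algR) ?ler0n //.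
by rewrite -sqrtr_sqr ler_sqrt ?exprn_ge0 ?ler0n // -natrX ler_nat.
Qed.

Lemma le_sqrt_nat (m n : nat) :
  (m%:R <= Num.sqrt (n%:R : algR))%R = (m ^ 2 <= n).
Proof.
rewrite -[X in (X <= _)%R](@ger0_norm algR) ?ler0n //.
by rewrite -sqrtr_sqr ler_sqrt ?ler0n // -natrX ler_nat.
Qed.

(** * Joining lines in a 2-design of index 1 *)

Section Design2.

Variables (T : finType) (v k : nat) (D : incidence T).
Hypothesis designD : design 2 v k 1 D.

Lemma design_block_sub L : L \in blocks D -> L \subset points D.
Proof. by case: designD => -[_ /(_ L) h] _ /h []. Qed.

Lemma design_block_card L : L \in blocks D -> #|L| = k.
Proof. by case: designD => -[_ /(_ L) h] _ /h []. Qed.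

Lemma design_line_exists Q R : Q \in points D -> R \in points D -> Q != R ->
  exists L, [/\ L \in blocks D, Q \in L & R \in L].
Proof.
move=> DQ DR neQR; case: designD => _ /(_ [set Q; R]).
rewrite subUset !sub1set DQ DR cards2 neQR => /(_ isT erefl)/eqP/cards1P[L eL].
have: L \in [set L] by rewrite set11.
by rewrite -eL inE subUset !sub1set => /and3P[]; exists L.
Qed.

Lemma design_line_unique L M Q R : L \in blocks D -> M \in blocks D ->
  Q != R -> Q \in L -> R \in L -> Q \in M -> R \in M -> L = M.
Proof.
move=> DL DM neQR QL RL QM RM; case: designD => _ /(_ [set Q; R]).
have /subsetP sL := design_block_sub DL.
rewrite subUset !sub1set !sL // cards2 neQR => /(_ isT erefl)/eqP/cards1P[N eN].
have: L \in [set N] by rewrite -eN inE DL subUset !sub1set QL.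
have: M \in [set N] by rewrite -eN inE DM subUset !sub1set QM.
by rewrite !inE => /eqP-> /eqP->.
Qed.

End Design2.

(** * Uncovered triples, added lines and simple points *)

Section Completion.

Variables (T : finType) (v n : nat) (I : incidence T) (E : T -> incidence T).
Hypothesis n_gt1 : 1 < n.
Hypothesis completesE : forall P, P \in points I ->
  completes 2 v n 1 (derived I P) (E P).

Implicit Types (P Q R S : T) (L M C : {set T}).

Notation added P := (added_lines (derived I P) (E P)).

Definition uncovered P Q R : bool :=
  [&& #|[set P; Q; R]| == 3, [set P; Q; R] \subset points I
    & block_degree I [set P; Q; R] == 0].

(** For [P] in [points I] this is the union of the added lines of [E P] through [Q], without [Q];
    phrased by uncovered triples, it does not depend on [E]. *)
Definition third_points P Q : {set T} := [set R | uncovered P Q R].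

Lemma uncoveredC P Q R : uncovered P Q R = uncovered Q P R.
Proof. by rewrite /uncovered (setUC [set P]). Qed.

Lemma uncoveredAC P Q R : uncovered P Q R = uncovered P R Q.
Proof. by rewrite /uncovered setUAC. Qed.

Lemma cards3 P Q R :
  (#|[set P; Q; R]| == 3) = [&& P != Q, P != R & Q != R].
Proof.
rewrite setUC cardsU1 cards2 !inE ![R == _]eq_sym.
by case: (P == Q); case: (P == R); case: (Q == R).
Qed.

Lemma third_pointsC P Q : third_points P Q = third_points Q P.
Proof. by apply/setP=> R; rewrite !inE uncoveredC. Qed.

Lemma uncovered_neq P Q R :
  uncovered P Q R -> [/\ P != Q, P != R & Q != R].
Proof. by case/and3P; rewrite cards3 => /and3P. Qed.

Lemma uncovered_points P Q R :
  uncovered P Q R -> [/\ P \in points I, Q \in points I & R \in points I].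
Proof. by case/and3P => _; rewrite !subUset !sub1set => /andP[/andP[]]. Qed.

Lemma designE P : P \in points I -> design 2 v n 1 (E P).
Proof. by case/completesE. Qed.

Lemma pointsE P : P \in points I -> points (E P) = points I :\ P.
Proof. by case/completesE. Qed.

Lemma lineP P L : P \in points I -> L \in blocks (E P) ->
  [/\ P \notin L, L \subset points I & #|L| = n].
Proof.
move=> XP EL; have := design_block_sub (designE XP) EL.
by rewrite pointsE // subsetD1 (design_block_card (designE XP) EL) => /andP[].
Qed.

Lemma circle_line P C : P \in points I -> C \in blocks I -> P \in C ->
  C :\ P \in blocks (E P).
Proof.
move=> XP IC PC; have [_ _ /subsetP] := completesE XP; apply.
by apply/imsetP; exists C; rewrite // inE IC.
Qed.

Lemma addedP P L : P \in points I ->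
  (L \in added P) = (L \in blocks (E P)) && (P |: L \notin blocks I).
Proof.
move=> XP; rewrite in_setD andbC; case EL: (L \in _) => //=; congr (~~ _).
have [PL _ _] := lineP XP EL.
apply/imsetP/idP => [[C /[!inE]/andP[IC PC] ->]|IL]; first by rewrite setD1K.
by exists (P |: L); rewrite ?setU1K // inE IL setU11.
Qed.

Lemma added_line P L : L \in added P -> L \in blocks (E P).
Proof. by case/setDP. Qed.

(** A circle through [P], [Q], [R] would induce a line of [E P] joining [Q] and [R]; that line is
    [L], so [P |: L] would be a circle. *)
Lemma added_uncovered P L Q R : P \in points I -> L \in added P ->
  Q \in L -> R \in L -> Q != R -> uncovered P Q R.
Proof.
move=> XP; rewrite addedP // => /andP[EL nIL] QL RL neQR.
have [PL /subsetP sL _] := lineP XP EL.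
have nePQ : P != Q by apply: contraNneq PL => ->.
have nePR : P != R by apply: contraNneq PL => ->.
rewrite /uncovered cards3 nePQ nePR neQR !subUset !sub1set XP !sL //=.
rewrite /block_degree cards_eq0; apply/eqP/setP => C; rewrite !inE.
apply/negP => /andP[IC]; rewrite !subUset !sub1set -andbA => /and3P[PC QC RC].
case/negP: nIL; rewrite -(_ : C :\ P = L) ?setD1K //.
apply: (design_line_unique (designE XP) (circle_line XP IC PC) EL neQR) => //.
  by rewrite !inE eq_sym nePQ.
by rewrite !inE eq_sym nePR.
Qed.

(** The line of [E P] joining [Q] and [R] cannot come from a circle, which would cover the
    triple. *)
Lemma uncovered_added P Q R : uncovered P Q R ->
  exists L, [/\ L \in added P, Q \in L & R \in L].
Proof.
move=> u; have [XP XQ XR] := uncovered_points u.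
have [nePQ nePR neQR] := uncovered_neq u.
have [||L [EL QL RL]] := design_line_exists (designE XP) _ _ neQR.
- by rewrite pointsE // !inE eq_sym nePQ.
- by rewrite pointsE // !inE eq_sym nePR.
exists L; split=> //; rewrite addedP // EL; apply/negP => IL.
case/and3P: u => _ _; rewrite cards_eq0 => /eqP/setP/(_ (P |: L)).
by rewrite !inE IL !subUset !sub1set !inE eqxx QL RL !orbT.
Qed.

Lemma added_third_points P L Q : P \in points I -> L \in added P -> Q \in L ->
  L :\ Q \subset third_points P Q.
Proof.
move=> XP aL QL; apply/subsetP => R /setD1P[neRQ RL]; rewrite inE.
by apply: added_uncovered aL _ _ _ => //; rewrite eq_sym.
Qed.

Lemma card_lineD1 P L Q : P \in points I -> L \in added P -> Q \in L ->
  #|L :\ Q| = n.-1.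
Proof.
by move=> XP /added_line/(lineP XP)[_ _ <-] QL; rewrite (cardsD1 Q L) QL.
Qed.

(* This reformulation of simplicity is symmetric in [P] and [Q]. *)
Lemma simpleP P Q : P \in points I ->
  (Q \in simple_points (derived I P) (E P)) = (#|third_points P Q| == n.-1).
Proof.
move=> XP; rewrite inE; apply/andP/eqP => [[EQ /cards1P[L eL]]|cQ].
  have: L \in [set L] by rewrite set11.
  rewrite -eL inE => /andP[aL QL].
  rewrite -(card_lineD1 XP aL QL); congr #|pred_of_set _|.
  apply/eqP; rewrite eqEsubset added_third_points // andbT.
  apply/subsetP => R; rewrite inE => u.
  have [M [aM QM RM]] := uncovered_added u.
  have: M \in [set L] by rewrite -eL inE aM QM.
  have [_ _ neQR] := uncovered_neq u.
  by rewrite inE => /eqP <-; rewrite !inE eq_sym neQR.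
(* As [n > 1], there is a third point, hence at least one added line through [Q]. *)
have /card_gt0P[R]: 0 < #|third_points P Q| by rewrite cQ -ltnS prednK // ltnW.
rewrite inE => u; have [L [aL QL RL]] := uncovered_added u.
split.
  by apply: (subsetP (design_block_sub (designE XP) (added_line aL))).
(* Each added line through [Q] has [n.-1] further points, all of them third points, so it exhausts
   these. *)
have eqU M : M \in added P -> Q \in M -> M :\ Q = third_points P Q.
  move=> aM QM; apply/eqP; rewrite eqEcard added_third_points //=.
  by rewrite cQ (card_lineD1 XP aM QM).
apply/cards1P; exists L; apply/setP => M; rewrite in_set1 in_set.
apply/andP/eqP => [[aM QM]|->] //.
by rewrite -(setD1K QM) -(setD1K QL) !eqU.
Qed.

Lemma simple_sym P Q : P \in points I -> Q \in points I ->
  (Q \in simple_points (derived I P) (E P)) =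
  (P \in simple_points (derived I Q) (E Q)).
Proof. by move=> XP XQ; rewrite !simpleP // third_pointsC. Qed.

Lemma simple_third_points P L Q : P \in points I -> L \in added P -> Q \in L ->
  Q \in simple_points (derived I P) (E P) -> third_points P Q = L :\ Q.
Proof.
move=> XP aL QL; rewrite simpleP // => /eqP cQ.
by apply/esym/eqP; rewrite eqEcard added_third_points //= cQ (card_lineD1 XP aL).
Qed.

(** By symmetry [P] is simple in [E Q], and its added line there consists of [P] and
    [third_points Q P], which is [L :\ Q]. *)
Lemma added_swap P L Q : P \in points I -> L \in added P -> Q \in L ->
  Q \in simple_points (derived I P) (E P) -> (P |: L) :\ Q \in added Q.
Proof.
move=> XP aL QL sQ; have [PL /subsetP sL _] := lineP XP (added_line aL).
have nePQ : P != Q by apply: contraNneq PL => ->.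
have XQ := sL _ QL; have eL := simple_third_points XP aL QL sQ.
have /card_gt0P[R]: 0 < #|L :\ Q|.
  by rewrite (card_lineD1 XP aL) // -ltnS prednK // ltnW.
rewrite -eL third_pointsC inE => u; have [M [aM PM RM]] := uncovered_added u.
rewrite simple_sym // in sQ.
have eM := simple_third_points XQ aM PM sQ.
suff -> : (P |: L) :\ Q = M by [].
rewrite -(setD1K PM) -eM third_pointsC eL.
by apply/setP=> S; rewrite !inE; case: (eqVneq S P) => //= ->; rewrite nePQ.
Qed.

(** The [n.-1] points of [C :\ R] other than [S] are third points of [R] and [S]; simplicity leaves
    room for no others, so they fill the added line through [S]. *)
Lemma added_of_simple R C S : R \in points I -> R \in C -> #|C| = n.+1 ->
  S \in C :\ R -> S \in simple_points (derived I R) (E R) ->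
  (forall Q, Q \in C :\ R -> Q != S -> uncovered R S Q) ->
  C :\ R \in added R.
Proof.
move=> XR RC cC SC sS uS.
have cS : #|(C :\ R) :\ S| = n.-1.
  by move: cC; rewrite (cardsD1 R C) RC (cardsD1 S (C :\ R)) SC => -[<-].
have /card_gt0P[Q /setD1P[neQS CQ]]: 0 < #|(C :\ R) :\ S|.
  by rewrite cS -ltnS prednK // ltnW.
have [M [aM SM _]] := uncovered_added (uS _ CQ neQS).
suff -> : C :\ R = M by [].
rewrite -(setD1K SC) -(setD1K SM) -(simple_third_points XR aM SM sS).
congr (_ |: _); apply/eqP; rewrite eqEcard cS.
move: sS; rewrite simpleP // => /eqP ->; rewrite leqnn andbT.
by apply/subsetP=> Z /setD1P[neZS CZ]; rewrite inE uS.
Qed.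

(* The lines of [E R] joining [S] to the points of [A] are pairwise distinct. *)
Lemma card_added_through R M (A : {set T}) S : R \in points I -> M \in added R ->
  A \subset M -> S \notin M -> (forall Q, Q \in A -> uncovered R S Q) ->
  #|A| <= #|added_through (derived I R) (E R) S|.
Proof.
move=> XR aM /subsetP sAM SM uA.
(* The default [set0] is never taken for [Q] in [A]. *)
pose f Q := odflt set0
  [pick L in added_through (derived I R) (E R) S | Q \in L].
have fP Q : Q \in A -> [/\ f Q \in added R, S \in f Q & Q \in f Q].
  move=> AQ; rewrite /f; case: pickP => [L /andP[/[!inE]/andP[]]|no] //=.
  have [L [aL SL QL]] := uncovered_added (uA _ AQ).
  by have := no L; rewrite inE aL SL QL.
rewrite -(card_in_imset (f := f)).
  apply/subset_leq_card/subsetP => _ /imsetP[Q /fP[? ? _] ->].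
  by rewrite inE; apply/andP.
(* A line shared by two points of [A] would meet [M] twice, hence equal [M], which misses [S]. *)
move=> Q Q' AQ AQ' eff; apply/eqP; apply: contraNT SM => neQQ'.
have [aF SF QF] := fP _ AQ; have [_ _ Q'F] := fP _ AQ'.
rewrite -eff in Q'F.
suff <- : f Q = M by [].
by apply: (design_line_unique (designE XR) _ _ neQQ'); rewrite ?sAM ?added_line.
Qed.

(** * Transfer of added lines from one base point to another *)

Hypothesis many_or_one : forall P, P \in points I ->
  many_simple_points n (derived I P) (E P) \/
  at_most_one_multiple_point (derived I P) (E P).

Lemma added_through_gt0 P L Q : L \in added P -> Q \in L ->
  0 < #|added_through (derived I P) (E P) Q|.
Proof. by move=> aL QL; apply/card_gt0P; exists L; rewrite inE aL. Qed.

Lemma simple_or_multiple P L Q : P \in points I -> L \in added P -> Q \in L ->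
  (Q \in simple_points (derived I P) (E P)) ||
  (Q \in [set Q in points (E P) | 1 < #|added_through (derived I P) (E P) Q|]).
Proof.
move=> XP aL QL; have EQ : Q \in points (E P).
  by apply: (subsetP (design_block_sub (designE XP) (added_line aL))).
by rewrite !inE EQ /= eq_sym -leq_eqVlt; apply: added_through_gt0 aL QL.
Qed.

(** Case (i) gives the first bound. In case (ii) a non-simple point of [L] is multiple, so [L] has
    at most one. *)
Lemma card_simple_on_line P L : P \in points I -> L \in added P ->
  let s := #|L :&: simple_points (derived I P) (E P)| in
  n <= s ^ 2 \/ n <= s.+1.
Proof.
move=> XP aL s; have [[/(_ _ aL) + _]|one] := many_or_one XP.
  by rewrite sqrt_nat_le; left.
right; have [_ _ <-] := lineP XP (added_line aL).
rewrite -(cardsID (simple_points (derived I P) (E P)) L) -addn1 leq_add2l.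
apply: leq_trans one; apply/subset_leq_card/subsetP => Q /setDP[QL /negbTE nsQ].
by have := simple_or_multiple XP aL QL; rewrite nsQ.
Qed.

Lemma added_move P L R : P \in points I -> L \in added P -> R \in L ->
  (P |: L) :\ R \in added R.
Proof.
move=> XP aL RL; have [PL /subsetP sL cL] := lineP XP (added_line aL).
have XR := sL _ RL; have neRP : R != P by apply: contraNneq PL => <-.
have [sR|nsR] := boolP (R \in simple_points (derived I P) (E P)).
  exact: added_swap.
set s := L :&: simple_points (derived I P) (E P).
(* Cases (i) and (ii) may differ between [P] and [R], so both bounds at [P] are kept. *)
have hs : n <= #|s| ^ 2 \/ n <= #|s|.+1 := card_simple_on_line XP aL.
have /card_gt0P[Q /setIP[QL sQ]] : 0 < #|s|.
  by case: hs; case: #|s| n_gt1 => // n1 /(leq_trans n1).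
have neQR : Q != R by apply: contraNneq nsR => <-.
have nePQ : P != Q by apply: contraNneq PL => ->.
have neQP := nePQ; rewrite eq_sym in neQP.
have RC : R \in P |: L by rewrite !inE RL orbT.
have cC : #|P |: L| = n.+1 by rewrite cardsU1 PL cL.
have cCR : #|(P |: L) :\ R| = n.
  by apply: succn_inj; rewrite -cC (cardsD1 R (P |: L)) RC.
have PC : P \in (P |: L) :\ R by rewrite !inE eqxx eq_sym neRP.
have QC : Q \in (P |: L) :\ R by rewrite !inE QL neQR orbT.
have uP S : S \in (P |: L) :\ R -> S != P -> uncovered R P S.
  rewrite !inE => /andP[neSR /orP[->//|SL] neSP].
  by rewrite uncoveredC; apply: added_uncovered aL _ _ _; rewrite // eq_sym.
(* For [Z] in [s], the swapped line is added in [E Z] and contains both [R] and [S]. *)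
have us Z S : Z \in P |: s -> S \in (P |: L) :\ R -> S != Z -> uncovered R Z S.
  case/setU1P=> [->|/setIP[ZL sZ] SC neSZ]; first exact: uP.
  have neZR : Z != R by apply: contraNneq nsR => <-.
  have aZ := added_swap XP aL ZL sZ.
  case/setD1P: SC => neSR SC.
  rewrite uncoveredC; apply: added_uncovered aZ _ _ _; rewrite ?sL //.
  - by rewrite !inE RL eq_sym neZR orbT.
  - by rewrite in_setD1 neSZ.
  - by rewrite eq_sym.
have Ps : P \in P |: s by rewrite setU11.
have Qs : Q \in P |: s by rewrite !inE QL /=; rewrite inE in sQ; rewrite sQ orbT.
have [M [aM PM QM]] := uncovered_added (us P Q Ps QC neQP).
have doneP : P \in simple_points (derived I R) (E R) ->
    (P |: L) :\ R \in added R.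
  by move=> sP; apply: added_of_simple sP _ => // Z CZ; apply: us.
have doneQ : Q \in simple_points (derived I R) (E R) ->
    (P |: L) :\ R \in added R.
  by move=> sQ'; apply: added_of_simple sQ' _ => // Z CZ; apply: us.
have [[simp lesqrt]|one] := many_or_one XR; last first.
  have /orP[/doneP //|mP] := simple_or_multiple XR aM PM.
  have /orP[/doneQ //|mQ] := simple_or_multiple XR aM QM.
  suff /subset_leq_card : [set P; Q] \subset
      [set Q in points (E R) | 1 < #|added_through (derived I R) (E R) Q|].
    by rewrite cards2 nePQ => /leq_trans/(_ one).
  by rewrite subUset !sub1set; apply/andP.
have /card_gt0P[Y /setIP[YM sY]] :
    0 < #|M :&: simple_points (derived I R) (E R)|.
  have := simp _ aM; rewrite sqrt_nat_le.
  by case: #|_| => // /(leq_trans n_gt1).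
have [eYP|neYP] := eqVneq Y P; first by apply: doneP; rewrite -eYP.
have [eYQ|neYQ] := eqVneq Y Q; first by apply: doneQ; rewrite -eYQ.
have [RM /subsetP sM cM] := lineP XR (added_line aM).
have neYR : Y != R by apply: contraNneq RM => <-.
(* Swapping [M] to base point [Y] shows that [Y], [P], [Q] is uncovered; as [Q] is simple in [E P],
   this puts [Y] on [L]. *)
have aY := added_swap XR aM YM sY.
have uYPQ : uncovered Y P Q.
  by apply: added_uncovered aY _ _ nePQ;
    rewrite ?sM // !inE ?PM ?QM ?orbT eq_sym andbT.
have /setD1P[_ YL] : Y \in L :\ Q.
  rewrite -(simple_third_points XP aL QL sQ) inE.
  by rewrite uncoveredAC uncoveredC.
have YC : Y \in (P |: L) :\ R by rewrite !inE neYR YL orbT.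
have sAM : P |: s \subset M.
  apply/subsetP => Z AZ; have [->//|neZY] := eqVneq Z Y.
  have : Z \in third_points R Y.
    by rewrite inE uncoveredAC; apply: us; rewrite // eq_sym.
  by rewrite (simple_third_points XR aM YM sY) => /setD1P[].
suff sCM : (P |: L) :\ R \subset M.
  by rewrite (_ : _ :\ R = M) //; apply/eqP; rewrite eqEcard sCM cCR cM leqnn.
apply/subsetP => S SC; apply: contraT => SM.
have : #|P |: s| <= #|added_through (derived I R) (E R) S|.
  apply: (card_added_through XR aM sAM SM) => Z AZ.
  rewrite uncoveredAC; apply: us => //.
  by apply: contraNneq SM => ->; apply: (subsetP sAM).
have := lesqrt S; rewrite le_sqrt_nat pointsE //.
have -> : #|P |: s| = #|s|.+1 by rewrite cardsU1 inE (negbTE PL).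
have -> : S \in points I :\ R.
  have /setD1P[neSR] := SC; rewrite !inE neSR => /orP[/eqP->//|].
  exact: sL.
(* Now [#|s|.+1 ^ 2 <= n], which contradicts either bound in [hs]; the second one uses [n > 1]. *)
move=> /(_ isT) le_n lt_s.
move: lt_s; rewrite -leq_sqr => /leq_trans/(_ le_n).
rewrite leqNgt => /negP[].
case: hs => [hs|hs]; first by apply: leq_ltn_trans hs _; rewrite ltn_sqr.
by apply: leq_ltn_trans (hs) _; rewrite ltn_Pmulr ?(leq_trans n_gt1 hs).
Qed.

(** * The completed structure and its derived structures *)

(** Nonemptiness excludes [set0], for which the line condition is vacuous. *)
Definition completion : incidence T :=
  Incidence (points I)
    [set C : {set T} | [&& C \subset points I, C != set0
                         & [forall P in C, C :\ P \in blocks (E P)]]].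

Lemma completion_line P C : C \in blocks completion -> P \in C ->
  P \in points I /\ C :\ P \in blocks (E P).
Proof.
by rewrite inE => /and3P[/subsetP sC _ /forall_inP hC] PC; rewrite sC ?hC.
Qed.

(** If [P |: L] is a circle of [I], its derived sets are lines at once; otherwise [added_move] makes
    them lines. *)
Lemma line_completion P L : P \in points I -> L \in blocks (E P) ->
  P |: L \in blocks completion.
Proof.
move=> XP EL; have [PL sL _] := lineP XP EL.
rewrite inE subUset sub1set XP sL -card_gt0 cardsU1 PL /=.
apply/forall_inP => R /setU1P[->|RL]; first by rewrite setU1K.
have [IC|nIC] := boolP (P |: L \in blocks I).
  by apply: circle_line; rewrite ?(subsetP sL) // !inE RL orbT.
by apply/added_line/added_move; rewrite // addedP // EL.
Qed.

Lemma blocksI_completion C : C \in blocks I -> C \subset points I ->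
  C != set0 -> C \in blocks completion.
Proof.
move=> IC sC C0; rewrite inE sC C0.
by apply/forall_inP => P PC; apply: circle_line; rewrite ?(subsetP sC).
Qed.

Lemma derived_completion P : P \in points I -> derived completion P = E P.
Proof.
move=> XP; case eE: (E P) (pointsE XP) => [X B] /= ->; congr Incidence.
rewrite -[B]/(blocks (Incidence X B)) -eE.
apply/setP => L; apply/imsetP/idP => [[C /setIdP[JC PC] ->]|EL].
  by have [] := completion_line JC PC.
have [PL _ _] := lineP XP EL.
by exists (P |: L); rewrite ?setU1K // inE setU11 line_completion.
Qed.

End Completion.

(** * Passing between designs and their derived designs *)

Section Derived.

Variables (T : finType).
Implicit Types (D : incidence T) (P : T) (C S : {set T}).

Lemma mem_blocks_derived D P C : P \in C ->
  (C :\ P \in blocks (derived D P)) = (C \in blocks D).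
Proof.
move=> PC; apply/imsetP/idP => [[C' /setIdP[DC' PC'] eC]|DC].
  by rewrite -(setD1K PC) eC setD1K.
by exists C; rewrite // inE DC.
Qed.

(** Deleting [P] is injective on the blocks containing [P]. *)
Lemma block_degree_derived D P S : P \notin S ->
  block_degree (derived D P) S = block_degree D (P |: S).
Proof.
move=> PS; rewrite /block_degree.
have -> : [set L in blocks (derived D P) | S \subset L] =
          [set C :\ P | C in [set C in blocks D | P |: S \subset C]].
  apply/setP => L; apply/idP/imsetP => [/setIdP[/imsetP[C]]|[C]].
    rewrite inE => /andP[DC PC] -> SC; exists C => //.
    by rewrite inE DC subUset sub1set PC (subset_trans SC) ?subsetDl.
  case/setIdP => DC; rewrite subUset sub1set => /andP[PC SC] ->.
  by rewrite inE mem_blocks_derived // DC subsetD1 SC.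
rewrite card_in_imset // => C C'; rewrite !inE !subUset !sub1set.
by move=> /and3P[_ PC _] /and3P[_ PC' _] eC; rewrite -(setD1K PC) eC setD1K.
Qed.

Lemma derived_design t v k lam D P : design t.+1 v.+1 k.+1 lam D ->
  P \in points D -> design t v k lam (derived D P).
Proof.
move=> [[cD uD] dD] XP; split; first split => [|L /imsetP[C /setIdP[DC PC] ->]].
- by apply: succn_inj; rewrite -cD (cardsD1 P (points D)) XP.
- have [sC cC] := uD _ DC; rewrite setSD //; split=> //.
  by apply: succn_inj; rewrite -cC (cardsD1 P C) PC.
move=> S; rewrite subsetD1 => /andP[sS PS] cS.
by rewrite block_degree_derived // dD ?subUset ?sub1set ?XP // cardsU1 PS cS.
Qed.

Lemma derived_completes t v k lam D D' P :
  completes t.+1 v.+1 k.+1 lam D D' -> P \in points D ->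
  completes t v k lam (derived D P) (derived D' P).
Proof.
move=> [dD' eX sB] XP; split; first by apply: derived_design; rewrite ?eX.
  by rewrite /= eX.
by apply/imsetS/subsetP => C; rewrite !inE => /andP[/(subsetP sB)-> ->].
Qed.

(** Blocks have [k.+1] points, so each is nonempty and recoverable from the derived structure at one
    of its points. *)
Lemma blocks_sub_of_derived v k D D' : uniform_on v k.+1 D ->
  (forall P, P \in points D -> derived D P = derived D' P) ->
  blocks D \subset blocks D'.
Proof.
move=> [_ uD] eD; apply/subsetP => C DC; have [/subsetP sC cC] := uD _ DC.
have /card_gt0P[P PC] : 0 < #|C| by rewrite cC.
by rewrite -(mem_blocks_derived _ PC) -eD ?sC // mem_blocks_derived.
Qed.

Lemma design_of_derived t v k lam D : #|points D| = v.+1 ->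
  (forall C, C \in blocks D -> C \subset points D /\ C != set0) ->
  (forall P, P \in points D -> design t v k lam (derived D P)) ->
  design t.+1 v.+1 k.+1 lam D.
Proof.
move=> cD hD dD; split; first split=> // C DC.
  have [sC /set0Pn[P PC]] := hD _ DC; split=> //.
  have [[_ /(_ (C :\ P))] + _] := dD _ (subsetP sC _ PC).
  by rewrite mem_blocks_derived // (cardsD1 P C) PC => /(_ DC)[_ ->].
move=> S sS cS; have /card_gt0P[P PS] : 0 < #|S| by rewrite cS.
have [_ /(_ (S :\ P)) <-] := dD _ (subsetP sS _ PS).
- by rewrite block_degree_derived ?setD1K // !inE eqxx.
- by rewrite setSD.
- by apply: succn_inj; rewrite -cS (cardsD1 P S) PS.
Qed.

End Derived.

(** * Existence and uniqueness of the full 3-design *)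

Theorem theorem8 (n d : nat) (hn : 2 <= n) (hd : 2 <= d)
    (T : finType) (I : incidence T)
    (hI : partial_design 3 (n ^ d + 1) (n + 1) 1 I)
    (hder : forall P : T, P \in points I ->
       exists E : incidence T,
         unique (completes 2 (n ^ d) n 1 (derived I P)) E /\
         (many_simple_points n (derived I P) E \/
          at_most_one_multiple_point (derived I P) E)) :
  exists! J : incidence T, completes 3 (n ^ d + 1) (n + 1) 1 I J.
Proof.
(* Finite choice collects the extensions into a function; outside [points I] its value is a
   dummy. *)
have /fin_all_exists[E hE] (P : T) : exists E : incidence T,
    P \in points I -> unique (completes 2 (n ^ d) n 1 (derived I P)) E /\
      (many_simple_points n (derived I P) E \/
       at_most_one_multiple_point (derived I P) E).
  have [/hder[E hE]|_] := boolP (P \in points I); first by exists E.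
  by exists I.
move: hI; rewrite !addn1 => -[[cI uI] _].
have compE P : P \in points I -> completes 2 (n ^ d) n 1 (derived I P) (E P).
  by move=> /hE[[]].
have uniqE P : P \in points I ->
    forall F, completes 2 (n ^ d) n 1 (derived I P) F -> E P = F.
  by move=> /hE[[]].
have caseE P : P \in points I -> many_simple_points n (derived I P) (E P) \/
    at_most_one_multiple_point (derived I P) (E P).
  by move=> /hE[].
have derJ := derived_completion hn compE caseE.
have dJ : design 3 (n ^ d).+1 n.+1 1 (completion I E).
  apply: design_of_derived => // [C|P XP].
    by rewrite inE => /and3P[].
  by rewrite derJ //; have [] := compE _ XP.
exists (completion I E); split.
  split=> //; apply/subsetP => C IC; have [sC cC] := uI _ IC.
  have C0 : C != set0 by rewrite -card_gt0 cC.
  exact: (blocksI_completion compE).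
(* Deriving any completion [J] at [P] completes [derived I P], hence yields [E P]; these derived
   structures determine the blocks. *)
move=> J cJ; have [[uJ _] eX _] := cJ.
have eder P : P \in points I -> derived (completion I E) P = derived J P.
  by move=> XP; rewrite derJ //; apply: uniqE => //; apply: derived_completes.
have eB : blocks (completion I E) = blocks J.
  apply/eqP; rewrite eqEsubset (blocks_sub_of_derived (proj1 dJ)) // andTb.
  by apply: (blocks_sub_of_derived uJ) => P; rewrite eX => /eder.
by case: J eX eB {cJ uJ eder} => X B /= -> <-.
Qed.
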